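(* Let $\alpha_1,\alpha_2,\beta>0$ and $k_1,k_2,r\in\mathbb{N}$, and consider the two-coupled system of time-space fractional partial differential equations $$\frac{\partial^{\alpha_p}u_p}{\partial t^{\alpha_p}}=\hat G_p[u_1,u_2],\qquad p=1,2,$$ for $u_1=u_1(x,t)$, $u_2=u_2(x,t)$, where for $p=1,2$ $$\hat G_p[u_1,u_2]=G_p\left(x,u_1,u_2,\frac{\partial^{\beta}u_1}{\partial x^{\beta}},\frac{\partial^{\beta}u_2}{\partial x^{\beta}},\dots,\frac{\partial^{\beta}}{\partial x^{\beta}}\left(\frac{\partial^{\beta}u_1}{\partial x^{\beta}}\right),\frac{\partial^{\beta}}{\partial x^{\beta}}\left(\frac{\partial^{\beta}u_2}{\partial x^{\beta}}\right),\frac{\partial^{r\beta}u_1}{\partial x^{r\beta}},\frac{\partial^{r\beta}u_2}{\partial x^{r\beta}},\frac{\partial^{\beta+k_p}u_1}{\partial x^{\beta+k_p}},\frac{\partial^{\beta+k_p}u_2}{\partial x^{\beta+k_p}}\right)$$ and $G_1,G_2$ are given sufficiently smooth functions of their arguments (so $\hat G_1,\hat G_2$ are linear or nonlinear fractional differential operators in $x$). For $p=1,2$ let $\mathcal{W}^p_{n_p}=\left\{\sum_{j=1}^{n_p}a^p_j\varphi^p_j(x): a^p_j\in\mathbb{R}\right\}$ be the finite-dimensional linear space over $\mathbb{R}$ spanned by linearly independent functions $\varphi^p_1,\dots,\varphi^p_{n_p}$. Suppose these spaces are invariant, that is, for $p=1,2$, $\hat G_p[w_1,w_2]\in\mathcal{W}^p_{n_p}$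 for all $(w_1,w_2)\in\mathcal{W}^1_{n_1}\times\mathcal{W}^2_{n_2}$, and let $\Phi^p_j:\mathbb{R}^{n_1+n_2}\to\mathbb{R}$ ($j=1,\dots,n_p$, $p=1,2$) be the expansion coefficients defined by $$\hat G_p\left[\sum_{j=1}^{n_1}a^1_j\varphi^1_j(x),\sum_{j=1}^{n_2}a^2_j\varphi^2_j(x)\right]=\sum_{j=1}^{n_p}\Phi^p_j(a^1_1,\dots,a^1_{n_1},a^2_1,\dots,a^2_{n_2})\varphi^p_j(x)$$ for all real $a^1_1,\dots,a^1_{n_1},a^2_1,\dots,a^2_{n_2}$. Then the two-coupled system admits the exact solution $$u_p(x,t)=\sum_{j=1}^{n_p}A^p_j(t)\varphi^p_j(x),\qquad p=1,2,$$ where the coefficients $A^p_j(t)$ satisfy the system of fractional ordinary differential equations $$\frac{d^{\alpha_p}A^p_j(t)}{dt^{\alpha_p}}=\Phi^p_j\left(A^1_1(t),\dots,A^1_{n_1}(t),A^2_1(t),\dots,A^2_{n_2}(t)\right),\qquad j=1,\dots,n_p,\ p=1,2;$$ that is, whenever the functions $A^p_j$ satisfy this system, $(u_1,u_2)$ is a solution of the two-coupled system.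
   Context: The time and space fractional derivatives $\partial^{\alpha}/\partial t^{\alpha}$ and $\partial^{\beta}/\partial x^{\beta}$ are taken in the Riemann–Liouville sense or in the Caputo sense, with lower terminal $0$, in the variable indicated with the other variable held fixed. For a function $g$ of one variable $t>0$ and order $\alpha>0$ with $n-1<\alpha<n$, $n\in\mathbb{N}$: - Riemann–Liouville: $\dfrac{1}{\Gamma(n-\alpha)}\dfrac{d^n}{dt^n}\displaystyle\int_0^t\frac{g(s)}{(t-s)^{\alpha-n+1}}\,ds$; - Caputo: $\dfrac{1}{\Gamma(n-\alpha)}\displaystyle\int_0^t\frac{g^{(n)}(s)}{(t-s)^{\alpha-n+1}}\,ds$; and if $\alpha=n\in\mathbb{N}$ both are the ordinary derivative $g^{(n)}(t)$. The variables range over $x>0$, $t>0$. All fractional derivatives appearing (of the $\varphi^p_j$ in $x$ and of the $A^p_j$ in $t$) are understood to exist. When $\hat G_p$ is applied to functions of $x$ alone, the same formula is used with $x$-derivatives of those functions; when applied to functions of $(x,t)$ it acts in $x$ for each fixed $t$. *)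

(* Defs.v *)
From HB Require Import structures.
From mathcomp Require Import all_boot all_order all_algebra.
From mathcomp Require Import all_classical all_reals all_analysis.
Set Implicit Arguments.
Unset Strict Implicit.
Unset Printing Implicit Defensive.
Import Order.TTheory GRing.Theory Num.Theory.
Import numFieldNormedType.Exports.
Local Open Scope classical_set_scope.
Local Open Scope ring_scope.

Definition Gamma (R : realType) (z : R) : R :=
  \int[@lebesgue_measure R]_(s in `]0, +oo[) (s `^ (z - 1) * expR (- s)).

Inductive frac_sense := RiemannLiouville | Caputo.

(* The natural number n with n - 1 < a <= n, for a > 0. *)
Definition frac_ord (R : realType) (a : R) : nat := `|Num.ceil a|%N.

Definition frac_kernel (R : realType) (a : R) (g : R -> R) (t s : R) : R :=
  g s / (t - s) `^ (a - (frac_ord a)%:R + 1).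

Definition frac_int (R : realType) (a : R) (g : R -> R) (t : R) : R :=
  \int[@lebesgue_measure R]_(s in `]0, t[) frac_kernel a g t s.

(* Fractional derivative of order a, lower terminal 0, at t > 0.  Only the
   values of g on ]0, +oo[ matter.  It is a total function, meaningful under
   [frac_derivable] below. *)
Definition frac_deriv (R : realType) (sense : frac_sense) (a : R)
    (g : R -> R) (t : R) : R :=
  let n := frac_ord a in
  if a == n%:R then derive1n n g t else
  match sense with
  | RiemannLiouville => (Gamma (n%:R - a))^-1 * derive1n n (frac_int a g) t
  | Caputo => (Gamma (n%:R - a))^-1 * frac_int a (derive1n n g) t
  end.

Definition derivable_upto (R : realType) (n : nat) (g : R -> R) : Prop :=
  forall m, (m < n)%N -> forall t, 0 < t -> derivable (derive1n m g) t 1.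

Definition frac_integrable (R : realType) (a : R) (g : R -> R) : Prop :=
  forall t, 0 < t ->
    (@lebesgue_measure R).-integrable `]0, t[ (EFin \o frac_kernel a g t).

(* Existence of the fractional derivative of order a on ]0, +oo[. *)
Definition frac_derivable (R : realType) (sense : frac_sense) (a : R)
    (g : R -> R) : Prop :=
  let n := frac_ord a in
  if a == n%:R then derivable_upto n g else
  match sense with
  | RiemannLiouville => frac_integrable a g /\ derivable_upto n (frac_int a g)
  | Caputo => derivable_upto n g /\ frac_integrable a (derive1n n g)
  end.

(* The x-derivatives built from the order b:
   [Iter j] is the sequential derivative D^b (... (D^b w)), j times,
   [Mult j] is D^(j b), and [Shift j] is D^(b + j). *)
Inductive xderiv := Iter of nat | Mult of nat | Shift of nat.

Definition xderiv_app (R : realType) (sense : frac_sense) (b : R)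
    (d : xderiv) (w : R -> R) : R -> R :=
  match d with
  | Iter j => iter j (frac_deriv sense b) w
  | Mult j => frac_deriv sense (j%:R * b) w
  | Shift j => frac_deriv sense (b + j%:R) w
  end.

Definition xderivable (R : realType) (sense : frac_sense) (b : R)
    (d : xderiv) (w : R -> R) : Prop :=
  match d with
  | Iter j => forall i, (i < j)%N ->
      frac_derivable sense b (iter i (frac_deriv sense b) w)
  | Mult j => frac_derivable sense (j%:R * b) w
  | Shift j => frac_derivable sense (b + j%:R) w
  end.

(* The derivatives on which G depends: w, D^b w, ..., D^b (D^b w), D^(r b) w,
   D^(b + k) w, where [dots] stands for the ellipsis and is arbitrary. *)
Definition xargs (dots : seq xderiv) (r k : nat) : seq xderiv :=
  [:: Iter 0; Iter 1] ++ dots ++ [:: Iter 2; Mult r; Shift k].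

(* The matrix argument of G has one row per derivative and one column per
   component of the pair w. *)
Definition Ghat (R : realType) (sense : frac_sense) (b : R) (ds : seq xderiv)
    (G : R * 'M[R]_(size ds, 2) -> R) (w : 'I_2 -> R -> R) (x : R) : R :=
  G (x, \matrix_(i < size ds, q < 2)
          xderiv_app sense b (tnth (in_tuple ds) i) (w q) x).

(* Class C^N on an open set D of a finite-dimensional space. *)
Fixpoint C_class_on (R : realType) (V : normedModType R) (N : nat)
    (f : V -> R) (D : set V) : Prop :=
  (forall z, D z -> {for z, continuous f}) /\
  match N with
  | 0%N => True
  | N'.+1 => forall v : V, (forall z, D z -> derivable f z v) /\
                           C_class_on N' ('D_v f) D
  end.

(* Functions of x are considered on x > 0 only. *)
Definition lin_comb (R : realType) (n : nat) (phi : 'I_n -> R -> R)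
    (a : 'I_n -> R) (x : R) : R := \sum_(j < n) a j * phi j x.

Definition lin_space (R : realType) (n : nat) (phi : 'I_n -> R -> R) :
    set (R -> R) :=
  [set w | exists a : 'I_n -> R, forall x, 0 < x -> w x = lin_comb phi a x].

Definition lin_indep (R : realType) (n : nat) (phi : 'I_n -> R -> R) : Prop :=
  forall a : 'I_n -> R, (forall x, 0 < x -> lin_comb phi a x = 0) ->
    forall j, a j = 0.

(* u solves D_t^(al p) u_p = Ghat_p[u_1, u_2], p = 1, 2, on x > 0, t > 0; all
   the derivatives involved are required to exist. *)
Definition is_solution (R : realType) (tsense xsense : frac_sense)
    (al : 'I_2 -> R) (b : R) (ds : 'I_2 -> seq xderiv)
    (G : forall p : 'I_2, R * 'M[R]_(size (ds p), 2) -> R)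
    (u : 'I_2 -> R -> R -> R) : Prop :=
  forall p : 'I_2,
  [/\ forall x, 0 < x -> frac_derivable tsense (al p) (fun t => u p x t),
      forall t, 0 < t -> forall (i : 'I_(size (ds p))) (q : 'I_2),
        xderivable xsense b (tnth (in_tuple (ds p)) i) (fun x => u q x t)
    & forall x t, 0 < x -> 0 < t ->
        frac_deriv tsense (al p) (fun t' => u p x t') t =
        Ghat xsense b (@G p) (fun q x' => u q x' t) x].

(* Main.v *)
(* The equation for u follows from [Phi_def] at a = A(t), for each fixed t,
   once D_t^al is pulled through the finite sum.  Linearity of the fractional
   derivatives on finite sums of fractionally differentiable functions also
   yields the existence of the derivatives of u. *)
Require Import Defs.
From HB Require Import structures.
From mathcomp Require Import all_boot all_order all_algebra.
From mathcomp Require Import all_classical all_reals all_analysis.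
Import Order.TTheory GRing.Theory Num.Theory.
Import numFieldNormedType.Exports.
Local Open Scope classical_set_scope.
Local Open Scope ring_scope.

(** A derivative at [t > 0] sees only values near [t], and these can be taken positive. Keeping [f]
    apart from [lin_comb g c], with agreement on the positive half-line only, lets the result be
    applied to derivatives and fractional integrals of combinations, where no identity is known for
    nonpositive arguments. *)
Lemma is_derive_lin_comb {R : realType} {n : nat} {g : 'I_n -> R -> R}
    {c : 'I_n -> R} {f : R -> R} {t : R} :
  (forall s, 0 < s -> f s = lin_comb g c s) ->
  (forall j, derivable (g j) t 1) -> 0 < t ->
  is_derive t 1 f (lin_comb (fun j => derive1 (g j)) c t).
Proof.
move=> fE dg t0.
have near_fE : \near t, lin_comb g c t = f t.
  by near=> s; rewrite fE //; near: s; exact: lt_nbhsr.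
apply: near_eq_is_derive near_fE _.
(* The pointwise sum is recast as a sum of functions, the form to which the sum rule for derivatives
   applies. *)
rewrite (_ : lin_comb g c = \sum_(j < n) (c j \*: g j)).
  apply: is_derive_sum => j; rewrite derive1E.
  by have := derivableP (dg j) => ?; exact: is_deriveZ.
by apply/funext => s; rewrite fct_sumE.
Unshelve. all: by end_near. Qed.

Lemma derive1n_lin_comb {R : realType} {m n : nat} {g : 'I_n -> R -> R}
    {c : 'I_n -> R} {f : R -> R} :
  (forall t, 0 < t -> f t = lin_comb g c t) ->
  (forall j, derivable_upto m (g j)) ->
  forall t, 0 < t ->
    derive1n m f t = lin_comb (fun j => derive1n m (g j)) c t.
Proof.
move=> fE; elim: m => [|m IH] dg t t0; first exact: fE.
have dg' j : derivable_upto m (g j).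
  by move=> i im; apply: (dg j i); exact: ltnW.
(* The induction hypothesis holds on the whole half-line, so it can itself be differentiated. *)
have := is_derive_lin_comb (IH dg') (fun j => dg j m (ltnSn m) t t0) t0.
by move=> df; rewrite derive1nS derive1E derive_val.
Qed.

Lemma derivable_upto_lin_comb {R : realType} {m n : nat} {g : 'I_n -> R -> R}
    {c : 'I_n -> R} {f : R -> R} :
  (forall t, 0 < t -> f t = lin_comb g c t) ->
  (forall j, derivable_upto m (g j)) -> derivable_upto m f.
Proof.
move=> fE dg i im t t0.
have dgi j : derivable_upto i (g j).
  by move=> l li; apply: (dg j l); exact: ltn_trans im.
by have [] := is_derive_lin_comb (derive1n_lin_comb fE dgi)
  (fun j => dg j i im t t0) t0.
Qed.

Lemma frac_kernel_lin_comb {R : realType} {n : nat} {g : 'I_n -> R -> R}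
    {c : 'I_n -> R} {f : R -> R} (a t s : R) :
  (forall s, 0 < s -> f s = lin_comb g c s) -> 0 < s ->
  frac_kernel a f t s = \sum_(j < n) c j * frac_kernel a (g j) t s.
Proof.
move=> fE s0; rewrite /frac_kernel fE // /lin_comb mulr_suml.
by apply: eq_bigr => j _; rewrite mulrA.
Qed.

Lemma frac_integrable_lin_comb {R : realType} {n : nat} {g : 'I_n -> R -> R}
    {c : 'I_n -> R} {f : R -> R} {a : R} :
  (forall t, 0 < t -> f t = lin_comb g c t) ->
  (forall j, frac_integrable a (g j)) -> frac_integrable a f.
Proof.
move=> fE ig t t0.
apply: (@eq_integrable _ _ _ (@lebesgue_measure R) `]0, t[ _
  (fun s => \sum_(j < n) ((c j)%:E * (frac_kernel a (g j) t s)%:E))%E) => //.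
  move=> s; rewrite inE /= in_itv /= => /andP[s0 _].
  by rewrite (frac_kernel_lin_comb _ _ _ fE s0) -sumEFin.
by apply: integrable_sum => // j _; apply: integrableZl => //; exact: ig.
Qed.

(** Integrability of each kernel allows the finite sum and the constants to leave the extended-real
    integral; the integration range []0, t[] meets only positive arguments, where [f] is known. *)
Lemma frac_int_lin_comb {R : realType} {n : nat} {g : 'I_n -> R -> R}
    {c : 'I_n -> R} {f : R -> R} {a : R} :
  (forall t, 0 < t -> f t = lin_comb g c t) ->
  (forall j, frac_integrable a (g j)) ->
  forall t, 0 < t -> frac_int a f t = lin_comb (fun j => frac_int a (g j)) c t.
Proof.
move=> fE ig t t0; rewrite /frac_int /Rintegral.
have -> : (\int[@lebesgue_measure R]_(s in `]0%R, t[) (frac_kernel a f t s)%:E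
  = \sum_(j < n) (c j)%:E *
      \int[@lebesgue_measure R]_(s in `]0%R, t[) (frac_kernel a (g j) t s)%:E)%E.
  rewrite (@eq_integral _ _ _ (@lebesgue_measure R) `]0, t[ (fun s =>
      \sum_(j < n) ((c j)%:E * (frac_kernel a (g j) t s)%:E))%E); last first.
    move=> s; rewrite inE /= in_itv /= => /andP[s0 _].
    by rewrite (frac_kernel_lin_comb _ _ _ fE s0) -sumEFin.
  rewrite integral_sum //; last first.
    by move=> j; apply: integrableZl => //; exact: ig.
  by apply: eq_bigr => j _; rewrite integralZl //; exact: ig.
(* Back to real values: [fine] passes through the sum and the products because integrability makes
   every integral finite. *)
rewrite /lin_comb -sum_fine => [|j _].
  apply: eq_bigr => j _; rewrite fineM //.
  by apply: integrable_fin_num => //; exact: ig.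
by rewrite fin_numM //; apply: integrable_fin_num => //; exact: ig.
Qed.

Lemma lin_combZ {R : realType} {n : nat} (g : 'I_n -> R -> R) (c : 'I_n -> R)
    (k t : R) :
  k * lin_comb g c t = lin_comb (fun j s => k * g j s) c t.
Proof. by rewrite mulr_sumr; apply: eq_bigr => j _; rewrite mulrCA. Qed.

(** The two senses compose the same two linear operations in opposite orders. Linearity of the inner
    one (integral for Riemann-Liouville, derivative for Caputo) supplies the identity on the
    half-line that the outer one requires. *)
Lemma frac_derivable_lin_comb {R : realType} {n : nat} {g : 'I_n -> R -> R}
    {c : 'I_n -> R} {f : R -> R} {sense : frac_sense} {a : R} :
  (forall t, 0 < t -> f t = lin_comb g c t) ->
  (forall j, frac_derivable sense a (g j)) -> frac_derivable sense a f.
Proof.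
move=> fE; rewrite /frac_derivable; case: ifP => _.
  exact: derivable_upto_lin_comb fE.
case: sense => dg.
- have ig j := (dg j).1.
  split; first exact: frac_integrable_lin_comb fE ig.
  exact: derivable_upto_lin_comb (frac_int_lin_comb fE ig) (fun j => (dg j).2).
- have dg1 j := (dg j).1.
  split; first exact: derivable_upto_lin_comb fE dg1.
  exact: frac_integrable_lin_comb (derive1n_lin_comb fE dg1) (fun j => (dg j).2).
Qed.

Lemma frac_deriv_lin_comb {R : realType} {n : nat} {g : 'I_n -> R -> R}
    {c : 'I_n -> R} {f : R -> R} {sense : frac_sense} {a : R} :
  (forall t, 0 < t -> f t = lin_comb g c t) ->
  (forall j, frac_derivable sense a (g j)) ->
  forall t, 0 < t ->
    frac_deriv sense a f t = lin_comb (fun j => frac_deriv sense a (g j)) c t.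
Proof.
move=> fE; rewrite /frac_derivable /frac_deriv; case: (a == _).
  exact: derive1n_lin_comb fE.
(* The Gamma factor is common to all terms, so it is taken out of the combination and cancelled. *)
case: sense => dg t t0; rewrite -lin_combZ; congr (_ * _).
- have ig j := (dg j).1.
  exact: derive1n_lin_comb (frac_int_lin_comb fE ig) (fun j => (dg j).2) t t0.
- have dg1 j := (dg j).1.
  exact: frac_int_lin_comb (derive1n_lin_comb fE dg1) (fun j => (dg j).2) t t0.
Qed.

Lemma iter_frac_deriv_lin_comb {R : realType} {n : nat} {g : 'I_n -> R -> R}
    {c : 'I_n -> R} {sense : frac_sense} {b : R} {i : nat} :
  (forall j, xderivable sense b (Iter i) (g j)) ->
  forall x, 0 < x -> iter i (frac_deriv sense b) (lin_comb g c) x =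
    lin_comb (fun j => iter i (frac_deriv sense b) (g j)) c x.
Proof.
elim: i => // i IH dg.
(* The role of [f] is played by the [i]-th iterate of the combination. *)
apply: (frac_deriv_lin_comb _ (fun j => dg j i (ltnSn i))).
by apply: IH => j l li; apply: (dg j l); exact: ltnW.
Qed.

Lemma xderivable_lin_comb {R : realType} {n : nat} {g : 'I_n -> R -> R}
    (c : 'I_n -> R) {sense : frac_sense} {b : R} {d : xderiv} :
  (forall j, xderivable sense b d (g j)) ->
  xderivable sense b d (lin_comb g c).
Proof.
case: d => [i|i|i] dg; [|exact: frac_derivable_lin_comb dg..].
move=> l li; apply: (frac_derivable_lin_comb _ (fun j => dg j l li)).
apply: iter_frac_deriv_lin_comb => j m ml.
by apply: (dg j m); exact: ltn_trans li.
Qed.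

Theorem theorem2p6 (R : realType) (tsense xsense : frac_sense)
  (al : 'I_2 -> R) (b : R) (k : 'I_2 -> nat) (r : nat)
  (dots : 'I_2 -> seq xderiv)
  (G : forall p : 'I_2, R * 'M[R]_(size (xargs (dots p) r (k p)), 2) -> R)
  (N : nat)
  (n : 'I_2 -> nat) (phi : forall p : 'I_2, 'I_(n p) -> R -> R)
  (Phi : forall p : 'I_2, 'I_(n p) -> (forall q : 'I_2, 'I_(n q) -> R) -> R)
  (al_gt0 : forall p, 0 < al p) (b_gt0 : 0 < b)
  (k_gt0 : forall p, (0 < k p)%N) (r_gt0 : (0 < r)%N)
  (G_smooth : forall p, C_class_on N (G p) [set z | 0 < z.1])
  (n_gt0 : forall p, (0 < n p)%N)
  (phi_indep : forall p, lin_indep (phi p))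
  (phi_derivable : forall (p : 'I_2) (i : 'I_(size (xargs (dots p) r (k p))))
     (q : 'I_2) (j : 'I_(n q)),
     xderivable xsense b (tnth (in_tuple (xargs (dots p) r (k p))) i) (phi q j))
  (invariant : forall w : 'I_2 -> R -> R,
     (forall q, lin_space (phi q) (w q)) ->
     forall p, lin_space (phi p) (Ghat xsense b (G p) w))
  (Phi_def : forall (a : forall q : 'I_2, 'I_(n q) -> R) (p : 'I_2) (x : R),
     0 < x ->
     Ghat xsense b (G p) (fun q => lin_comb (phi q) (a q)) x =
     \sum_(j < n p) Phi p j a * phi p j x)
  (A : forall p : 'I_2, 'I_(n p) -> R -> R)
  (A_derivable : forall p j, frac_derivable tsense (al p) (A p j))
  (A_sol : forall p j t, 0 < t ->
     frac_deriv tsense (al p) (A p j) t = Phi p j (fun q i => A q i t)) :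
  is_solution tsense xsense al b G
    (fun p x t => \sum_(j < n p) A p j t * phi p j x).
Proof.
move=> p; split.
(* With [x] fixed, the [A p j] are the functions combined and the values [phi p j x] the constants;
   for the [x]-derivatives below, with [t] fixed, these roles are exchanged. *)
- move=> x x0; apply: (@frac_derivable_lin_comb _ _ (A p) (phi p ^~ x)) => //.
  by move=> t _; apply: eq_bigr => j _; rewrite mulrC.
- move=> t t0 i q.
  exact: (xderivable_lin_comb (A q ^~ t)) (phi_derivable p i q).
- move=> x t x0 t0; rewrite (Phi_def (fun q j => A q j t)) //.
  rewrite (@frac_deriv_lin_comb _ _ (A p) (phi p ^~ x)) //.
    by apply: eq_bigr => j _; rewrite A_sol // mulrC.
  by move=> s _; apply: eq_bigr => j _; rewrite mulrC.
Qed.
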